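(* Let $X,Y$ be real Banach spaces, let $T\in\mathcal{L}(X,Y)$, and let $\mathcal{I},\mathcal{J}$ be ideals on $\omega$ such that $\mathcal{J}$ is strongly selective. Then a matrix $A=(A_{n,k}:n,k\in\omega)$ of linear operators in $\mathcal{L}(X,Y)$ satisfies $$A\in(c(X,\mathcal{I}),c(Y,\mathcal{J}))\ \text{ and }\ \mathcal{J}\text{-}\lim A\boldsymbol{x}=T(\mathcal{I}\text{-}\lim\boldsymbol{x})\ \text{ for all }\boldsymbol{x}\in c(X,\mathcal{I})$$ if and only if there exists $k_0\in\omega$ such that all of the following hold: (T1$^\flat$) there exists $J_0\in\mathcal{J}^\star$ for which $\sup_{n\in J_0}\|A_{n,\ge k_0}\|<\infty$ and, for all $n\in\omega\setminus J_0$, there exists $f(n)\in\omega$ such that $\|A_{n,\ge f(n)}\|<\infty$; (T3$^\sharp$) $\sum_kA_{n,k}x_k$ converges in the norm of $Y$ for all $\boldsymbol{x}\in c(X,\mathcal{I})$ and $n\in\omega$; (T4) $\mathcal{J}\text{-}\lim_n\sum_kA_{n,k}=T$; (T5$^\sharp$) $A\in(c_{00}(X,\mathcal{I}),c_0(Y,\mathcal{J}))$. In addition, if each $A_{n,k}$ is bounded, it is possible to choose $k_0=f(n)=0$ for all $n\in\omega\setminus J_0$.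
   Context: $\omega$ is the set of nonnegative integers. An ideal on $\omega$ is a family of subsets of $\omega$ closed under subsets and finite unions; every ideal is assumed to contain all finite sets and to differ from the power set of $\omega$. $\mathcal{J}^\star=\{S\subseteq\omega:\omega\setminus S\in\mathcal{J}\}$, $\mathcal{J}^+=\{S\subseteq\omega:S\notin\mathcal{J}\}$. An ideal $\mathcal{J}$ is strongly selective if for every decreasing sequence $(S_n)$ in $\mathcal{J}^+$ there is $S=\{x_n:n\in\omega\}\in\mathcal{J}^+$ (with $(x_n)$ the increasing enumeration of $S$) such that $x_{n+1}\in S_{x_n}$ for all $n\in\omega$. $\mathcal{I}\text{-}\lim_nx_n=\eta$ means $\{n:x_n\notin U\}\in\mathcal{I}$ for every neighborhood $U$ of $\eta$. For a Banach space $V$: $c(V,\mathcal{I})$ is the space of $\mathcal{I}$-convergent sequences; $c_0(V,\mathcal{I})$ those with $\mathcal{I}$-limit $0$; $c_{00}(V,\mathcal{I})$ those with $\{n:x_n\ne0\}\in\mathcal{I}$ (none of these sequences need be bounded). $\mathcal{L}(X,Y)$ is the space of all (not necessarily bounded) linear operators $X\to Y$, with the strong operator topology. For $E\subseteq\omega$, the group norm is $\|A_{n,E}\|=\sup\{\|\sum_{k\in F}A_{n,k}x_k\|:F\subseteq E\text{ finite},\ x_k\in X,\ \|x_k\|\le1\}\in[0,\infty]$; $A_{n,\ge k}=A_{n,\{k,k+1,\dots\}}$. $A\boldsymbol{x}=(A_n\boldsymbol{x})_n$, $A_n\boldsymbol{x}=\sum_kA_{n,k}x_k$, provided each series converges in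 norm. $A\in(\mathscr{A},\mathscr{B})$ means that $A\boldsymbol{x}$ is well defined and in $\mathscr{B}$ for every $\boldsymbol{x}\in\mathscr{A}$. $\mathcal{J}\text{-}\lim_n\sum_kA_{n,k}=T$ means: for all $x\in X$ and $n\in\omega$ the series $\sum_kA_{n,k}x$ converges in norm, and $\mathcal{J}\text{-}\lim_n\sum_kA_{n,k}x=Tx$ for all $x\in X$. *)

(* Defs.v *)
From HB Require Import structures.
From mathcomp Require Import all_boot all_order all_algebra.
From mathcomp Require Import finmap.
From mathcomp Require Import all_classical all_reals all_analysis.
Set Implicit Arguments.
Unset Strict Implicit.
Unset Printing Implicit Defensive.
Import Order.TTheory GRing.Theory Num.Theory.
Import numFieldNormedType.Exports.
Local Open Scope classical_set_scope.
Local Open Scope ring_scope.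

Definition is_ideal (I : set (set nat)) : Prop :=
  [/\ forall S S', S `<=` S' -> I S' -> I S,
      forall S S', I S -> I S' -> I (S `|` S'),
      forall S, finite_set S -> I S
    & ~ I setT].

Definition dual_filter (I : set (set nat)) : set (set nat) :=
  [set S | I (~` S)].

Definition positive_sets (I : set (set nat)) : set (set nat) :=
  [set S | ~ I S].

Definition strongly_selective (J : set (set nat)) : Prop :=
  forall S : nat -> set nat,
    (forall n, positive_sets J (S n)) ->
    (forall n, S n.+1 `<=` S n) ->
    exists x : nat -> nat,
      [/\ forall n, (x n < x n.+1)%N,
          positive_sets J (range x)
        & forall n, S (x n) (x n.+1)].

Section IdealSequenceSpaces.
Context {R : realType} {V : normedModType R}.

Definition ideal_lim (I : set (set nat)) (x : nat -> V) (eta : V) : Prop :=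
  forall U : set V, nbhs eta U -> I [set n | ~ U (x n)].

Definition c_space (I : set (set nat)) : set (nat -> V) :=
  [set x | exists eta, ideal_lim I x eta].

Definition c0_space (I : set (set nat)) : set (nat -> V) :=
  [set x | ideal_lim I x 0].

Definition c00_space (I : set (set nat)) : set (nat -> V) :=
  [set x | I [set n | x n <> 0]].

End IdealSequenceSpaces.

Section OperatorMatrices.
Context {R : realType} {X Y : normedModType R}.

(* The group norm of a row a = (A_{n,k})_k on E: the choice F = fset0 makes
   the supremum range over a nonempty set of nonnegative reals. *)
Definition group_norm (a : nat -> {linear X -> Y}) (E : set nat) : \bar R :=
  ereal_sup [set z | exists (F : {fset nat}) (x : nat -> X),
    [/\ [set` F] `<=` E,
        forall k, `|x k| <= 1
      & z = (`| \sum_(k <- F) a k (x k) |)%:E]].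

Definition from (k : nat) : set nat := [set i | (k <= i)%N].

Variable A : nat -> nat -> {linear X -> Y}.

Definition row_converges (x : nat -> X) (n : nat) : Prop :=
  cvgn (series (fun k => A n k (x k))).

(* Meaningful only under [row_converges x n]; [limn] is total. *)
Definition mx_apply (x : nat -> X) : nat -> Y :=
  fun n => limn (series (fun k => A n k (x k))).

Definition mx_maps (P : set (nat -> X)) (Q : set (nat -> Y)) : Prop :=
  forall x, P x -> (forall n, row_converges x n) /\ Q (mx_apply x).

Definition row_sums_lim (J : set (set nat)) (T : {linear X -> Y}) : Prop :=
  (forall x n, row_converges (fun=> x) n) /\
  (forall x, ideal_lim J (mx_apply (fun=> x)) (T x)).

Definition tail_bounds (J : set (set nat)) (k0 : nat) (J0 : set nat)
    (f : nat -> nat) : Prop :=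
  [/\ dual_filter J J0,
      (ereal_sup [set group_norm (A n) (from k0) | n in J0] < +oo)%E
    & forall n, ~ J0 n -> (group_norm (A n) (from (f n)) < +oo)%E].

Definition limit_preserving (I J : set (set nat)) (T : {linear X -> Y}) :
    Prop :=
  mx_maps (c_space I) (c_space J) /\
  forall x eta, ideal_lim I x eta -> ideal_lim J (mx_apply x) (T eta).

End OperatorMatrices.

(* Main.v *)
Require Import Defs.
From HB Require Import structures.
From mathcomp Require Import all_boot all_order all_algebra.
From mathcomp Require Import finmap.
From mathcomp Require Import all_classical all_reals all_analysis.
From mathcomp Require Import lra.
Import Order.TTheory GRing.Theory Num.Theory.
Import numFieldNormedType.Exports.
Local Open Scope classical_set_scope.
Local Open Scope ring_scope.

(** Sufficiency of the conditions is a splitting argument. By linearity and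
    the hypothesis on row sums, only sequences with I-limit 0 matter. Such a
    sequence is the sum of its restriction to an I-small set, which A sends to
    a J-null sequence, and of a sequence bounded by some small d and supported
    beyond k0, on which the rows in J0 are at most d times the uniform tail
    bound.

    The content of the converse is the existence of the bounds on group norms,
    and it only uses null sequences in the usual sense.

    - A single row whose series converges on all null sequences has a tail of
      finite group norm ([row_tail_bounded]): otherwise disjoint blocks with
      arbitrarily large sums, divided by factors tending to infinity, give a
      null sequence whose series is not Cauchy.

    - If no tail were uniformly bounded on a set of the dual filter of J, then
      for all k and M the set of the n with || A_{n,>=k} || > M would be
      J-positive. Strong selectivity, applied to the sets
      S_m = {n : || A_{n,>=g(m)} || > h(m)} for fast growing g and h, gives
      rows r_0 < r_1 < ... forming a J-positive set, such that row r_{j+1} has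
      a block in [g(r_j), g(r_{j+1})) on which it exceeds h(r_j). Gliding
      humps along these blocks produce a null sequence y with A y unbounded
      along the r_j, contradicting that A y is J-null
      ([selective_tail_bounded]). In row r_{j+1} the later blocks contribute
      at most 1, since they were scaled down by the tail bound of that row.
      The earlier blocks are not controlled at all: the sign of block j is
      chosen so that it does not cancel against them ([exists_sign]).

    - When the entries are bounded, each column is uniformly bounded on a set
      of the dual filter ([selective_uniform_boundedness]). This uniform
      boundedness principle follows from the previous point applied to the
      matrix with entries 2^-k L_n: for a null sequence y, completeness gives
      a vector x = sum_k 2^-k y_k, and the matrix maps y to (L_n x)_n. Adding
      finitely many column bounds to a tail bound yields k0 = 0. *)

(** * Group norms of tails as bounds on interval sums *)

Lemma sum_nat_drop {V : zmodType} (F : nat -> V) m m' N : (m <= m')%N ->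
  (forall k, (k < m')%N -> F k = 0) ->
  \sum_(m <= k < N) F k = \sum_(m' <= k < N) F k.
Proof.
move=> mm' F0; have [Nm'|/ltnW m'N] := leqP N m'.
  rewrite (big_geq Nm') big_nat big1// => k /andP[_ kN].
  exact/F0/(leq_trans kN).
rewrite (big_cat_nat mm' m'N)/= [X in X + _]big_nat.
by rewrite [X in X + _]big1 ?add0r// => k /andP[_ /F0].
Qed.

Section TailBounds.
Context {R : realType} {X Y : normedModType R}.
Implicit Types (a : nat -> {linear X -> Y}) (x : nat -> X).

(** The inequality ||a_{>=m}|| <= M, with finite subsets of [m, oo) replaced by
    intervals [m, N): a finite set is reached by putting zeros into x. *)
Definition tail_bounded a (m : nat) (M : R) : Prop :=
  forall x N, (forall k, `|x k| <= 1) ->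
    `| \sum_(m <= k < N) a k (x k) | <= M.

Lemma group_norm_from_le a m M :
  (group_norm a (from m) <= M%:E)%E <-> tail_bounded a m M.
Proof.
split=> [aM x N x1|aM].
- rewrite -lee_fin; apply: le_trans aM; apply: ereal_sup_ubound.
  exists [fset k in index_iota m N]%fset, x; split => //.
    by move=> k /=; rewrite !inE mem_index_iota => /andP[].
  congr (_%:E); congr (`| _ |); apply: perm_big; apply: uniq_perm.
  + exact: iota_uniq.
  + exact: fset_uniq.
  + by move=> k; rewrite !inE.
- apply: ge_ereal_sup => _ [F [x [Fm x1 ->]]].
  pose N := (\max_(k <- F) k).+1.
  have -> : \sum_(k <- F) a k (x k) =
      \sum_(m <= k < N) a k (if k \in F then x k else 0).
    under [RHS]eq_bigr do rewrite (fun_if (a _)) linear0.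
    rewrite -big_mkcond -big_filter; apply: perm_big; apply: uniq_perm.
    + exact: fset_uniq.
    + exact/filter_uniq/iota_uniq.
    + move=> k; rewrite mem_filter mem_index_iota.
      have [kF|//] := boolP (k \in F).
      by rewrite (Fm k kF) ltnS leq_bigmax_seq.
  rewrite lee_fin; apply: aM => k.
  by case: ifP => // _; rewrite normr0 ler01.
Qed.

Lemma group_norm_ge0 a E : (0 <= group_norm a E)%E.
Proof.
apply: ereal_sup_ubound; exists fset0, (fun=> 0); split => //.
  by move=> k; rewrite normr0.
by rewrite big_seq_fset0 normr0.
Qed.

Lemma group_norm_from_lty a m :
  (group_norm a (from m) < +oo)%E <-> exists M, tail_bounded a m M.
Proof.
split=> [|[M /group_norm_from_le aM]]; last first.
  exact: le_lt_trans aM (ltry _).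
move=> aoo; exists (fine (group_norm a (from m))).
apply/group_norm_from_le; by rewrite fineK// ge0_fin_numE// group_norm_ge0.
Qed.

Lemma sup_group_norm_lty (A : nat -> nat -> {linear X -> Y}) J0 m :
  (ereal_sup [set group_norm (A n) (from m) | n in J0] < +oo)%E <->
  exists M, forall n, J0 n -> tail_bounded (A n) m M.
Proof.
split=> [|[M AM]]; last first.
  apply: (@le_lt_trans _ _ M%:E); last exact: ltry.
  by apply: ge_ereal_sup => _ [n /AM ? <-]; apply/group_norm_from_le.
set s := ereal_sup _ => soo.
exists (fine s) => n J0n; apply/group_norm_from_le.
have sn : (group_norm (A n) (from m) <= s)%E by apply: ereal_sup_ubound; exists n.
by rewrite fineK// ge0_fin_numE// (le_trans (group_norm_ge0 _ _) sn).
Qed.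

Lemma tail_bounded_le a m m' M M' : (m <= m')%N -> M <= M' ->
  tail_bounded a m M -> tail_bounded a m' M'.
Proof.
move=> mm' MM' aM x N x1; apply: le_trans MM'.
pose x' k := if (m' <= k)%N then x k else 0.
have -> : \sum_(m' <= k < N) a k (x k) = \sum_(m <= k < N) a k (x' k).
  rewrite (sum_nat_drop _ m m' N mm') => [|k km']; last first.
    by rewrite /x' leqNgt km' linear0.
  by apply: eq_big_nat => k /andP[m'k _]; rewrite /x' m'k.
by apply: aM => k; rewrite /x'; case: ifP => // _; rewrite normr0 ler01.
Qed.

Lemma tail_bounded_scale a m M c x N : tail_bounded a m M -> 0 < c ->
  (forall k, (m <= k)%N -> `|x k| <= c) ->
  `| \sum_(m <= k < N) a k (x k) | <= c * M.
Proof.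
move=> aM c0 xc; pose x' k := if (m <= k)%N then c^-1 *: x k else 0.
have -> : \sum_(m <= k < N) a k (x k) = c *: \sum_(m <= k < N) a k (x' k).
  rewrite scaler_sumr; apply: eq_big_nat => k /andP[mk _].
  by rewrite /x' mk -linearZ scalerA divff ?gt_eqF// scale1r.
rewrite normrZ gtr0_norm// ler_pM2l//; apply: aM => k; rewrite /x'.
case: ifP => [/xc xk|_]; last by rewrite normr0 ler01.
by rewrite normrZ gtr0_norm ?invr_gt0// ler_pdivrMl// mulr1.
Qed.

Lemma tail_bounded_pred a k M M' : (forall v, `|v| <= 1 -> `|a k v| <= M) ->
  tail_bounded a k.+1 M' -> tail_bounded a k (M + M').
Proof.
move=> akM aM x N x1.
have [Nk|kN] := leqP N k; last first.
  by rewrite big_ltn//; apply: le_trans (ler_normD _ _) _; rewrite lerD ?akM ?aM.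
rewrite big_geq// normr0 addr_ge0//.
  exact: le_trans (normr_ge0 _) (akM _ (x1 0%N)).
exact: le_trans (normr_ge0 _) (aM _ 0%N x1).
Qed.

End TailBounds.

(** * Gliding humps *)

Lemma increasing_geq {p : nat -> nat} : (forall j, (p j < p j.+1)%N) ->
  forall j, (j <= p j)%N.
Proof. by move=> pS; elim=> // j IH; apply: leq_ltn_trans (pS j). Qed.

Lemma exists_block {p : nat -> nat} : (forall j, (p j < p j.+1)%N) ->
  forall i k, (p i <= k)%N -> exists2 j, (i <= j)%N & (p j <= k < p j.+1)%N.
Proof.
move=> pS i k pik.
have exP : exists j, (p j <= k)%N by exists i.
have ubP j : (p j <= k)%N -> (j <= k)%N.
  exact: leq_trans (increasing_geq pS j).
case: (ex_maxnP exP ubP) => j pjk jmax; exists j; first exact: jmax.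
by rewrite pjk ltnNge; apply/negP => /jmax; rewrite ltnn.
Qed.

(** The induction common to all gliding hump arguments: if at stage j, whatever
    the values z already fixed below [p j], values on the next block
    [p j, p j.+1) can be found that satisfy a requirement [Q j] depending only
    on what lies below [p j.+1], then one sequence satisfies all of them. *)
Lemma gliding_hump {T : Type} (x0 : T) {p : nat -> nat}
    (Q : nat -> (nat -> T) -> Prop) :
  (forall j, (p j < p j.+1)%N) ->
  (forall j u v, (forall k, (k < p j.+1)%N -> u k = v k) -> Q j u -> Q j v) ->
  (forall j z, exists u, Q j (fun k => if (k < p j)%N then z k else u k)) ->
  exists y, (forall j, Q j y).
Proof.
move=> pS Qloc Qex.
have [u uP] := choice (fun jz => Qex jz.1 jz.2).
pose z := fix z j := if j is j'.+1 then
  (fun k => if (k < p j')%N then z j' k else u (j', z j') k) else (fun=> x0).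
(* Stage j + 1 changes nothing below [p j], so the value at k is settled
   from any stage i with k < p i on; stage k + 1 is one of them. *)
have zstab i d k : (k < p i)%N -> z (i + d)%N k = z i k.
  elim: d => [|d IH] ki; first by rewrite addn0.
  rewrite addnS /= ifT ?IH//; apply: leq_trans ki _.
  by elim: (d) => [|e]; rewrite ?addn0// addnS => /leq_trans; apply; exact: ltnW.
exists (fun k => z k.+1 k) => j; apply: (Qloc j (z j.+1)); last exact: (uP (j, z j)).
move=> k kj.
have kk : (k < p k.+1)%N by exact: increasing_geq.
have [jk|kj'] := leqP j.+1 k.+1.
  by rewrite -(subnKC jk) zstab.
by rewrite -(subnKC (ltnW kj')) zstab.
Qed.

Lemma cvg0_blocks {R : realType} {X : normedModType R} {p : nat -> nat}
    (y : nat -> X) : (forall j, (p j < p j.+1)%N) ->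
  (forall j k, (p j <= k < p j.+1)%N -> `|y k| <= j.+1%:R^-1) ->
  y @ \oo --> (0 : X).
Proof.
move=> pS yp; apply/cvgr0Pnorm_le => e e0.
have ie : 0 <= e^-1 by rewrite invr_ge0 ltW.
exists (p (Num.truncn e^-1)) => //= k /(exists_block pS)[j ij /yp yk].
apply: le_trans yk _; rewrite invf_ple ?posrE// ltW//.
by apply: lt_le_trans (truncnS_gt _) _; rewrite ler_nat.
Qed.

(** If every tail had infinite group norm, then block j, starting at
    m = p j, could be chosen with sum larger than m + 1. Dividing it by m + 1
    makes the sequence null but keeps each block sum at least 1, so the series
    fails the Cauchy criterion. *)
Lemma row_tail_bounded {R : realType} {X Y : normedModType R}
    (a : nat -> {linear X -> Y}) :
  (forall y : nat -> X, y @ \oo --> (0 : X) ->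
    cvgn (series (fun k => a k (y k)))) ->
  exists m M, tail_bounded a m M.
Proof.
move=> acv; apply: contrapT => unb.
have wit m : exists xN : (nat -> X) * nat, (forall k, `|xN.1 k| <= 1) /\
    m.+1%:R < `| \sum_(m <= k < xN.2) a k (xN.1 k) |.
  apply: contrapT => H; apply: unb; exists m, m.+1%:R => x N x1.
  by rewrite leNgt; apply/negP => xN; apply: H; exists (x, N).
have [w wP] := choice wit.
have wN m : (m < (w m).2)%N.
  rewrite ltnNge; apply/negP => wm; have [_] := wP m.
  by rewrite big_geq// normr0 ltrn0.
pose p j := iter j (fun m => (w m).2) 0%N.
have pS j : (p j < p j.+1)%N by rewrite /= wN.
have [|j z|y Qy] := @gliding_hump X 0 p (fun j y =>
    1 <= `| \sum_(p j <= k < p j.+1) a k (y k) | /\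
    forall k, (p j <= k < p j.+1)%N -> `|y k| <= j.+1%:R^-1) pS.
- move=> j u v uv; rewrite (eq_big_nat _ _ (F2 := fun k => a k (v k))).
    by move=> [v1 vk]; split => // k /[dup] /andP[_ kj] /vk; rewrite uv.
  by move=> k /andP[_ kj]; rewrite uv.
- have [w1 wS] := wP (p j); exists (fun k => (p j).+1%:R^-1 *: (w (p j)).1 k).
  split.
    rewrite (eq_big_nat _ _ (F2 := fun k => (p j).+1%:R^-1 *: a k ((w (p j)).1 k))).
      rewrite -scaler_sumr normrZ gtr0_norm ?invr_gt0// ler_pdivlMl// mulr1.
      exact: ltW.
    by move=> k /andP[pk _]; rewrite ltnNge pk /= linearZ.
  move=> k /andP[pk _]; rewrite ltnNge pk /= normrZ gtr0_norm ?invr_gt0//.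
  apply: (@le_trans _ _ (p j).+1%:R^-1).
    by rewrite ler_piMr// invr_ge0.
  by rewrite lef_pV2 ?posrE// ler_nat ltnS increasing_geq.
have y0 : y @ \oo --> (0 : X).
  by apply: (cvg0_blocks y pS) => j k; exact: (Qy j).2.
have /cvg_cauchy/cauchy_seriesP/(_ 1 ltr01) := acv y y0.
move=> [[P1 P2] [/= [n1 _ P1n] [n2 _ P2n]] P12].
pose j := maxn n1 n2.
suff /P12 : (P1 `*` P2) (p j, p j.+1) by rewrite /= ltNge (Qy j).1.
split => /=.
  by apply: P1n => /=; rewrite (leq_trans (leq_maxl _ n2))// increasing_geq.
apply: P2n => /=; apply: leq_trans (leq_maxr n1 _) _.
exact: leq_trans (increasing_geq pS j) (ltnW (pS j)).
Qed.

(** * Limits along an ideal *)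

Section IdealLimits.
Context {R : realType} {V : normedModType R}.
Implicit Types (x y : nat -> V) (l : V).

Lemma ideal_limP {I : set (set nat)} : is_ideal I -> forall x l,
  ideal_lim I x l <-> forall e, 0 < e -> I [set n | e <= `|x n - l|].
Proof.
move=> [Isub _ _ _] x l; split=> [xl e e0|xl U].
  apply: Isub (xl _ (nbhsx_ballx l e e0)) => n /= en.
  by rewrite -ball_normE /= distrC; apply/negP; rewrite -leNgt.
move=> /nbhs_ballP[e /= e0 eU]; apply: Isub (xl e e0) => n /=.
rewrite leNgt distrC => nU; apply/negP => xe; apply: nU.
by apply: eU; rewrite -ball_normE.
Qed.

Lemma cvg_ideal_lim {I : set (set nat)} x l : is_ideal I -> x @ \oo --> l ->
  ideal_lim I x l.
Proof.
move=> [Isub _ Ifin _] xl U /xl [n _ nU].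
apply: Isub (Ifin _ (finite_II n)) => k /= Uk.
by rewrite ltnNge; apply/negP => nk; apply: Uk; exact: nU.
Qed.

Lemma ideal_lim_cst {I : set (set nat)} l : is_ideal I ->
  ideal_lim I (fun=> l) l.
Proof. by move=> hI; apply: cvg_ideal_lim => //; exact: cvg_cst. Qed.

Lemma ideal_limD {I : set (set nat)} x y l l' : is_ideal I ->
  ideal_lim I x l -> ideal_lim I y l' -> ideal_lim I (fun n => x n + y n) (l + l').
Proof.
move=> hI /(ideal_limP hI) xl /(ideal_limP hI) yl; apply/(ideal_limP hI) => e e0.
have e20 : 0 < e / 2 by rewrite divr_gt0.
have [Isub IU _ _] := hI; apply: Isub (IU _ _ (xl _ e20) (yl _ e20)) => n /= en.
case: (leP (e / 2) `|x n - l|) => [|xn]; first by left.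
right; rewrite /= leNgt; apply/negP => yn; move: en; apply/negP.
rewrite -ltNge opprD addrACA; apply: le_lt_trans (ler_normD _ _) _.
by rewrite (splitr e) ltrD.
Qed.

End IdealLimits.

Lemma c00_c0_space {R : realType} {V : normedModType R} (I : set (set nat))
  (x : nat -> V) : is_ideal I -> c00_space I x -> c0_space I x.
Proof.
move=> hI Ix; apply/(ideal_limP hI) => e e0.
have [Isub _ _ _] := hI; apply: Isub Ix => n /= en xn0.
by move: en; rewrite xn0 subr0 normr0 leNgt e0.
Qed.

(** * Values of a matrix on a sequence *)

Section RowApply.
Context {R : realType} {X Y : normedModType R} (A : nat -> nat -> {linear X -> Y}).
Implicit Types (x y : nat -> X).

Lemma row_converges_cvg {x n} : row_converges A x n ->
  series (fun k => A n k (x k)) @ \oo --> mx_apply A x n.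
Proof. by []. Qed.

Lemma mx_applyD {x y n} : row_converges A x n -> row_converges A y n ->
  row_converges A (fun k => x k + y k) n /\
  mx_apply A (fun k => x k + y k) n = mx_apply A x n + mx_apply A y n.
Proof.
move=> cx cy.
have E : series (fun k => A n k (x k + y k)) =
    series (fun k => A n k (x k)) + series (fun k => A n k (y k)).
  by rewrite -seriesD; congr series; apply/funext => k /=; rewrite linearD.
by rewrite /row_converges /mx_apply E; split; [exact: is_cvgD|exact: limD].
Qed.

Lemma mx_apply_delta k v n :
  mx_apply A (fun i => if i == k then v else 0) n = A n k v.
Proof.
rewrite /mx_apply; apply: cvg_lim; first exact: norm_hausdorff.
apply: cvg_near_cst; exists k.+1 => //= N /= kN.
rewrite seriesEnat /= big_mkord.
rewrite (bigD1 (Ordinal kN)) //= eqxx big1 ?addr0// => i ik.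
rewrite ifF ?linear0//; apply: contraNF ik => /eqP ik; exact/eqP/val_inj.
Qed.

Lemma mx_apply_norm_ge x n (c : R) N : row_converges A x n ->
  (forall M, (N <= M)%N -> c <= `|\sum_(0 <= k < M) A n k (x k)|) ->
  c <= `|mx_apply A x n|.
Proof.
move=> cx cN; have cvx := row_converges_cvg cx.
rewrite leNgt; apply/negP => /midf_lt [lt1 lt2].
have [M _ HM] := cvgr_norm_le _ cvx _ lt1.
have := cN (maxn M N) (leq_maxr _ _); rewrite leNgt => /negP; apply.
by apply: le_lt_trans lt2; apply: HM => /=; exact: leq_maxl.
Qed.

Lemma mx_apply_norm_le x n (c : R) : row_converges A x n ->
  (forall M, `|\sum_(0 <= k < M) A n k (x k)| <= c) -> `|mx_apply A x n| <= c.
Proof.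
move=> cx cN; have cvx := row_converges_cvg cx.
rewrite leNgt; apply/negP => cx1.
have /midf_lt [lt1 lt2] := cx1.
have [M _ HM] := cvgr_norm_ge _ cvx _ lt2.
have /= := HM M (leqnn _); rewrite leNgt => /negP; apply.
exact: le_lt_trans (cN M) lt1.
Qed.

End RowApply.

(** * The gliding hump argument along a strongly selective ideal *)

(** At stage n the value [g n] must dominate quantities depending on all earlier
    values of g. Since these are at most [g n.-1], it suffices to dominate the
    finite maximum of G over all k <= g n.-1, which makes g definable by
    recursion on its last value only. *)
Lemma exists_fast_growing (F : nat -> nat) (G : nat -> nat -> nat -> nat) :
  exists g : nat -> nat, [/\ forall n, (g n < g n.+1)%N,
    forall n, (F n <= g n)%N
    & forall m n, (m < n)%N -> (G n (g m) m <= g n)%N].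
Proof.
pose g := fix g n := if n is n'.+1 then
    maxn (maxn (g n').+1 (F n))
         (\max_(k < (g n').+1) \max_(m < n) G n k m)
  else F 0%N.
have gS n : (g n < g n.+1)%N by rewrite /= -maxnA leq_maxl.
have gmono m n : (m <= n)%N -> (g m <= g n)%N.
  by elim: n => [|n IH]; [rewrite leqn0 => /eqP->|
    rewrite leq_eqVlt => /predU1P[->//|/IH/leq_trans]; apply; exact: ltnW].
exists g; split => // [[|n]//=|m [//|n] mn /=].
  by apply: leq_trans (leq_maxl _ _); exact: leq_maxr.
apply: leq_trans (leq_maxr _ _); rewrite ltnS in mn.
have gmn : (g m < (g n).+1)%N by rewrite ltnS gmono.
apply: leq_trans (leq_bigmax (Ordinal gmn)).
exact: (leq_bigmax (F := fun i : 'I_n.+1 => G n.+1 (g m) i)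
  (Ordinal (mn : (m < n.+1)%N))).
Qed.

(** As 2b = (a + b) - (a - b), one of a + b and a - b is at least as long
    as b: a hump can be added to an uncontrolled head without cancellation. *)
Lemma exists_sign {R : realType} {Y : normedModType R} (a b : Y) :
  exists2 s : R, `|s| = 1 & `|b| <= `|a + s *: b|.
Proof.
have [ab|ab] := leP `|b| `|a + b|.
  by exists 1; rewrite ?normr1 ?scale1r.
exists (-1); rewrite ?normrN1// scaleN1r.
have : `|b| *+ 2 <= `|a + b| + `|a - b|.
  rewrite -normrMn; apply: le_trans (ler_normB _ _).
  by rewrite opprB addrC addrA subrK mulr2n.
by rewrite mulr2n => h; lra.
Qed.

(** Strong selectivity replaces the free choice of the next row in the classical
    gliding hump: it only guarantees that row r_{j+1} lies in a set
    prescribed in terms of r_j. Hence all growth conditions are prepared in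
    advance as functions g, h of the index of the previous row. *)
Lemma selective_tail_bounded {R : realType} {X Y : normedModType R}
    (J : set (set nat)) (A : nat -> nat -> {linear X -> Y}) :
  is_ideal J -> strongly_selective J ->
  (forall y : nat -> X, y @ \oo --> (0 : X) ->
    (forall n, row_converges A y n) /\ ideal_lim J (mx_apply A y) 0) ->
  exists k0 J0, dual_filter J J0 /\
    exists M, forall n, J0 n -> tail_bounded (A n) k0 M.
Proof.
move=> hJ Jsel Anull; have [Jsub JU Jfin _] := hJ; apply: contrapT => unb.
have Jpos k M : positive_sets J [set n | ~ tail_bounded (A n) k M].
  move=> JkM; apply: unb; exists k, [set n | tail_bounded (A n) k M].
  by split => //; exists M.
have /choice[f /choice[b fb]] n : exists m M, tail_bounded (A n) m M.
  by apply: row_tail_bounded => y /Anull[Ay _]; exact: Ay.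
(* B m bounds the tail norms of all rows up to m at once. *)
pose B (m : nat) : R := \sum_(i < m.+1) (1 + `|b i|).
have B_mono m n : (m <= n)%N -> B m <= B n.
  move=> mn; rewrite /B -!(big_mkord xpredT (fun i => 1 + `|b i|)).
  rewrite (big_cat_nat (leq0n m.+1) (mn : (m.+1 <= n.+1)%N))/= lerDl.
  by rewrite sumr_ge0.
have bB n : `|b n| < B n.
  rewrite /B big_ord_recr/= -[ltLHS]add0r ler_ltD//; last by rewrite ltrDr.
  by rewrite sumr_ge0.
have B_gt0 n : 0 < B n := le_lt_trans (normr_ge0 _) (bB n).
have B_ge1 n : 1 <= B n.
  apply: le_trans (B_mono 0%N n _) => //; rewrite /B big_ord1 lerDl.
  exact: normr_ge0.
(* Block j is scaled by c j = 1 / ((r_j + 1) B(r_j)); this h leaves it with size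
   at least r_j + 1 in row r_{j+1}. *)
pose h (m : nat) : R := m.+1%:R ^+ 2 * B m.
have h_mono m : h m <= h m.+1.
  apply: ler_pM; [exact: exprn_ge0|exact: ltW| |exact: B_mono].
  by rewrite lerXn2r ?nnegrE// ler_nat.
(* w (n, k, m) carries a block starting at k on which row n exceeds h m, and the
   end of that block. *)
have wit nkm : exists xN : (nat -> X) * nat,
    ~ tail_bounded (A nkm.1.1) nkm.1.2 (h nkm.2) ->
    (forall k, `|xN.1 k| <= 1) /\
    h nkm.2 < `| \sum_(nkm.1.2 <= k < xN.2) A nkm.1.1 k (xN.1 k) |.
  apply: contrapT => H; have tb : tail_bounded (A nkm.1.1) nkm.1.2 (h nkm.2).
    move=> x N x1; rewrite leNgt; apply/negP => xN; apply: H.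
    by exists (x, N) => _.
  by apply: H; exists (fun=> 0, 0%N) => /(_ tb).
have [w wP] := choice wit.
(* Beyond g n row n has a finite tail norm, and every block that row n needs
   after an earlier row m has ended. *)
have [g [gS fg wg]] := exists_fast_growing f (fun n k m => (w (n, k, m)).2).
have [||r [rS Jr Sr]] := Jsel (fun m => [set n | ~ tail_bounded (A n) (g m) (h m)]).
- by move=> m; exact: Jpos.
- move=> m n /= /[swap] tb; apply; apply: tail_bounded_le tb => //.
  exact: ltnW.
have g_mono : {mono g : m n / (m < n)%N}.
  by apply: leqW_mono; apply: leq_mono; exact: homo_ltn ltn_trans gS.
pose p j := g (r j).
have pS j : (p j < p j.+1)%N by rewrite /p g_mono.
pose c j : R := ((r j).+1%:R * B (r j))^-1.
have c_gt0 j : 0 < c j by rewrite invr_gt0 mulr_gt0.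
have hump j : exists u : nat -> X, (forall k, `|u k| <= 1) /\
    h (r j) < `| \sum_(p j <= k < p j.+1) A (r j.+1) k (u k) |.
  have [u1 uh] := wP (r j.+1, g (r j), r j) (Sr j).
  have wN := wg _ _ (rS j); set N := (w _).2 in uh wN; set u := (w _).1 in u1 uh.
  exists (fun k => if (k < N)%N then u k else 0); split => [k|].
    by case: ifP => // _; rewrite normr0.
  have pN : (p j <= N)%N.
    rewrite leqNgt; apply/negP => Np; move: uh; rewrite /= big_geq ?(ltnW Np)//.
    by rewrite normr0 ltNge mulr_ge0 ?exprn_ge0// ltW.
  rewrite (big_cat_nat pN wN)/= [X in _ + X]big_nat.
  rewrite [X in _ + X]big1 => [|k /andP[Nk _]]; last first.
    by rewrite ltnNge Nk linear0.
  rewrite addr0.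
  rewrite (eq_big_nat _ _ (F2 := fun k => A (r j.+1) k (u k)))
    => [|k /andP[_ ->]//].
  exact: uh.
(* The requirement on block j bounds the whole sum of row r_{j+1} up to the end
   of the block, head included. *)
have [||y Qy] := @gliding_hump X 0 p (fun j y =>
    (r j).+1%:R <= `| \sum_(0 <= k < p j.+1) A (r j.+1) k (y k) | /\
    forall k, (p j <= k < p j.+1)%N -> `|y k| <= c j) pS.
- move=> j u v uv; rewrite (eq_big_nat _ _ (F2 := fun k => A (r j.+1) k (v k))).
    by move=> [v1 vk]; split => // k /[dup] /andP[_ kj] /vk; rewrite uv.
  by move=> k /andP[_ kj]; rewrite uv.
- move=> j z; have [u [u1 uh]] := hump j.
  have [s s1 sab] := exists_sign (\sum_(0 <= k < p j) A (r j.+1) k (z k))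
    (c j *: \sum_(p j <= k < p j.+1) A (r j.+1) k (u k)).
  exists (fun k => s *: (c j *: u k)); split.
    rewrite (big_cat_nat (leq0n _) (ltnW (pS j)))/=.
    rewrite (eq_big_nat _ _ (F2 := fun k => A (r j.+1) k (z k))) => [|k /andP[_ ->]//].
    rewrite [X in _ + X](eq_big_nat _ _
      (F2 := fun k => s *: (c j *: A (r j.+1) k (u k)))).
      rewrite -2!scaler_sumr; apply: le_trans sab.
      rewrite normrZ gtr0_norm// ler_pdivlMl ?mulr_gt0//.
      by apply: le_trans (ltW uh); rewrite /h expr2 mulrAC.
    by move=> k /andP[pk _]; rewrite ltnNge pk /= linearZ/= linearZ.
  move=> k /andP[pk _]; rewrite ltnNge pk /= normrZ s1 mul1r normrZ gtr0_norm//.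
  by rewrite ler_piMr// ltW.
have y0 : y @ \oo --> (0 : X).
  apply: (cvg0_blocks y pS) => j k /(Qy j).2/le_trans; apply.
  rewrite lef_pV2 ?posrE ?mulr_gt0//.
  apply: (@le_trans _ _ (r j).+1%:R); first by rewrite ler_nat ltnS increasing_geq.
  by rewrite ler_peMr.
have ytail i k : (p i <= k)%N -> `|y k| <= (B (r i))^-1.
  move=> /(exists_block pS)[j ij /(Qy j).2/le_trans]; apply.
  rewrite lef_pV2 ?posrE ?mulr_gt0//.
  apply: (@le_trans _ _ (B (r j))); last by rewrite ler_peMl ?ler1n// ltW.
  by apply: B_mono; rewrite (leq_mono (homo_ltn ltn_trans rS)).
have [Ay Alim] := Anull y y0.
(* Row r_{j+1} is at least r_j + 1 up to the end of block j, and the later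
   blocks change it by at most b / B <= 1. *)
have Abig j : j%:R <= `|mx_apply A y (r j.+1)|.
  apply: (@mx_apply_norm_ge _ _ _ A y (r j.+1) _ (p j.+1)) => // N pN.
  rewrite (big_cat_nat (leq0n _) pN)/=.
  apply: le_trans (lerB_normD _ _); rewrite lerBrDr.
  apply: le_trans (Qy j).1; rewrite -natr1 lerD ?ler_nat ?increasing_geq//.
  have tb : tail_bounded (A (r j.+1)) (p j.+1) (b (r j.+1)).
    exact: tail_bounded_le (fg _) _ (fb _).
  apply: le_trans (tail_bounded_scale _ _ _ _ _ N tb _ (ytail j.+1)) _.
    by rewrite invr_gt0.
  by rewrite ler_pdivrMl// mulr1 (le_trans (ler_norm _))// ltW.
(* All r_j with j >= 2 lie in the J-small set where A y has norm at least 1. *)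
apply: Jr; have Jbig := (ideal_limP hJ _ _).1 Alim 1 ltr01.
apply: Jsub (JU _ _ (Jfin _ (finite_II (r 1%N).+1)) Jbig).
move=> _ [[|[|j]] _ <-] /=.
- by left; rewrite /= ltnS ltnW.
- by left => /=.
- by right; rewrite /= subr0; apply: le_trans (Abig _); rewrite ler1n.
Qed.

(** * Bounded entries *)

(** A uniform boundedness principle for J-null families. In the matrix with
    entries 2^-k L_n every tail norm is a multiple of the norm of L_n, so a
    uniform tail bound is a uniform bound on the operators. *)
Lemma selective_uniform_boundedness {R : realType}
    {X : completeNormedModType R} {Y : normedModType R}
    (J : set (set nat)) (L : nat -> {linear X -> Y}) :
  is_ideal J -> strongly_selective J ->
  (forall n, bounded_fun_norm (L n)) ->
  (forall x, ideal_lim J (fun n => L n x) 0) ->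
  exists J0, dual_filter J J0 /\
    exists M, forall n, J0 n -> forall v, `|v| <= 1 -> `|L n v| <= M.
Proof.
move=> hJ Jsel Lbd L0.
pose q : R := 2^-1; have q_gt0 : 0 < q by rewrite invr_gt0.
have q_lt1 : `|q| < 1 by rewrite gtr0_norm// invf_lt1// ltr1n.
pose C n k : {linear X -> Y} := (q ^+ k) \*: L n.
have [y y0|k0 [J0 [JJ0 [M CM]]]] := selective_tail_bounded J C hJ Jsel.
  have [K Ky] : exists K, forall k, `|y k| <= K.
    have /cvg_seq_bounded/pinfty_ex_gt0[K _ Ky] : cvgn y by apply/cvg_ex; exists 0.
    by exists K => k; exact: Ky.
  have K0 : 0 <= K := le_trans (normr_ge0 _) (Ky 0%N).
  have ycv : cvgn (series (fun k => q ^+ k *: y k)).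
    apply: normed_cvg; apply: (series_le_cvg (v_ := geometric K q)) => [k|k|k|].
    - exact: normr_ge0.
    - by apply: geometric_ge0 => //; exact: ltW.
    - by rewrite /= normrZ normrX gtr0_norm// mulrC ler_wpM2r// exprn_ge0// ltW.
    - exact: is_cvg_geometric_series.
  have CE n : series (fun k => C n k (y k)) =
      L n \o series (fun k => q ^+ k *: y k).
    apply/funext => N /=; rewrite !seriesEnat /= linear_sum.
    by apply: eq_bigr => k _; rewrite /= linearZ.
  have Ccv n : series (fun k => C n k (y k)) @ \oo -->
      L n (limn (series (fun k => q ^+ k *: y k))).
    rewrite CE; apply: (cvg_comp _ _ ycv).
    exact/bounded_linear_continuous/bounded_funP/Lbd.
  split => [n|]; first by apply/cvg_ex; eexists; exact: Ccv.
  rewrite (_ : mx_apply C y = fun n => L n (limn (series (fun k => q ^+ k *: y k)))).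
    exact: L0.
  apply/funext => n; apply: cvg_lim; [exact: norm_hausdorff|exact: Ccv].
exists J0; split => //; exists ((q ^+ k0)^-1 * M) => n /CM tb v v1.
have := tb (fun=> v) k0.+1 (fun=> v1).
by rewrite big_nat1 /= normrZ gtr0_norm ?exprn_gt0// ler_pdivlMl// exprn_gt0.
Qed.

Lemma dual_filterI {J : set (set nat)} S S' : is_ideal J ->
  dual_filter J S -> dual_filter J S' -> dual_filter J (S `&` S').
Proof. by move=> [_ JU _ _] JS JS'; rewrite /dual_filter /= setCI; exact: JU. Qed.

Lemma tail_bounded0 {R : realType} {X Y : normedModType R}
    (a : nat -> {linear X -> Y}) m M :
  (forall k, bounded_fun_norm (a k)) -> tail_bounded a m M ->
  exists M', tail_bounded a 0 M'.
Proof.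
move=> abd; elim: m M => [|m IH] M aM; first by exists M.
by have [M1 aM1] := abd m 1; apply: IH (tail_bounded_pred _ _ _ _ aM1 aM).
Qed.

Lemma dual_tail_bounded0 {R : realType} {X Y : normedModType R}
    (J : set (set nat)) (A : nat -> nat -> {linear X -> Y}) m J0 M :
  is_ideal J ->
  (forall k, exists J1, dual_filter J J1 /\
     exists M1, forall n, J1 n -> forall v, `|v| <= 1 -> `|A n k v| <= M1) ->
  dual_filter J J0 -> (forall n, J0 n -> tail_bounded (A n) m M) ->
  exists J1, dual_filter J J1 /\
    exists M1, forall n, J1 n -> tail_bounded (A n) 0 M1.
Proof.
move=> hJ Acol; elim: m J0 M => [|m IH] J0 M JJ0 AM.
  by exists J0; split => //; exists M.
have [J1 [JJ1 [M1 AM1]]] := Acol m.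
apply: (IH (J0 `&` J1) (M1 + M)); first exact: dual_filterI.
by move=> n [J0n J1n]; apply: tail_bounded_pred; [exact: AM1|exact: AM].
Qed.

(** * The characterization *)

Section LimitPreserving.
Context {R : realType} {X Y : completeNormedModType R}.
Variables (T : {linear X -> Y}) (I J : set (set nat)).
Variable A : nat -> nat -> {linear X -> Y}.
Hypotheses (hI : is_ideal I) (hJ : is_ideal J).

Lemma limit_preserving_of_tail_bounded k0 J0 M : dual_filter J J0 ->
  (forall n, J0 n -> tail_bounded (A n) k0 M) ->
  (forall x n, c_space I x -> row_converges A x n) ->
  row_sums_lim A J T -> mx_maps A (c00_space I) (c0_space J) ->
  limit_preserving A I J T.
Proof.
move=> JJ0 AM Acv [_ AT] A00.
have null x : ideal_lim I x 0 -> ideal_lim J (mx_apply A x) 0.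
  move=> x0; apply/(ideal_limP hJ) => e e0.
  pose d := e / 2 / (1 + `|M|).
  have M0 : 0 < 1 + `|M| by rewrite ltr_pwDl.
  have d0 : 0 < d by rewrite !divr_gt0.
  (* The indices below k0 join the I-small part, so that v is supported where
     the uniform tail bound applies. *)
  pose E : set nat := [set n | d <= `|x n - 0|] `|` `I_k0.
  have IE : I E.
    by have [_ IU Ifin _] := hI; apply: IU;
      [exact: ((ideal_limP hI _ _).1 x0)|exact/Ifin/finite_II].
  pose u k := if `[< E k >] then x k else 0.
  pose v k := if `[< E k >] then 0 else x k.
  have uE : c00_space I u.
    have [Isub _ _ _] := hI; apply: Isub IE => k /=; rewrite /u.
    by case: ifPn => [/asboolP|].
  have vd k : `|v k| <= d.
    rewrite /v; case: ifPn => [_|/asboolPn Ek]; first by rewrite normr0 ltW.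
    rewrite leNgt; apply/negP => dx; apply: Ek; left => /=.
    by rewrite subr0 ltW.
  have xuv : x = (fun k => u k + v k).
    by apply/funext => k; rewrite /u /v; case: ifP; rewrite ?addr0 ?add0r.
  have [ucv ulim] := A00 _ uE.
  have vc : c_space I v.
    exists 0; apply/(ideal_limP hI) => e' e'0.
    have [Isub _ _ _] := hI; apply: Isub ((ideal_limP hI _ _).1 x0 e' e'0) => k /=.
    rewrite /v; case: ifP => // _ /le_trans; apply.
    by rewrite subrr normr0.
  have [Jsub JU _ _] := hJ.
  have e20 : 0 < e / 2 by rewrite divr_gt0.
  apply: Jsub (JU _ _ JJ0 ((ideal_limP hJ _ _).1 ulim _ e20)) => n /= en.
  have [J0n|] := pselect (J0 n); last by left.
  right; move: en; rewrite !subr0 xuv (mx_applyD A (ucv n) (Acv _ n vc)).2 => en.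
  have vn : `|mx_apply A v n| <= e / 2.
    apply: mx_apply_norm_le => [|N]; first exact: Acv.
    rewrite (sum_nat_drop _ 0 k0)// => [|k kk0]; last first.
      by rewrite /v ifT ?linear0//; apply/asboolP; right.
    apply: le_trans (tail_bounded_scale _ _ _ _ _ N (AM n J0n) d0 _) _ => //.
    rewrite /d -(mulrA (e / 2)) ler_piMr ?(ltW e20)// ler_pdivrMl// mulr1.
    by rewrite (le_trans (ler_norm _))// lerDr.
  have := le_trans en (ler_normD _ _); lra.
have lim x l : ideal_lim I x l -> ideal_lim J (mx_apply A x) (T l).
  move=> xl; pose z k := x k - l.
  have z0 : ideal_lim I z 0.
    by rewrite -[0](subrr l); apply: ideal_limD => //; exact: ideal_lim_cst.
  have zc : c_space I z by exists 0.
  have lc : c_space I (fun=> l) by exists l; exact: ideal_lim_cst.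
  have -> : mx_apply A x = fun n => mx_apply A z n + mx_apply A (fun=> l) n.
    apply/funext => n; rewrite -(mx_applyD A (Acv _ n zc) (Acv _ n lc)).2.
    by congr mx_apply; apply/funext => k; rewrite /z subrK.
  by rewrite -[T l]add0r; apply: ideal_limD; [|exact: null|exact: AT].
split => // x [l xl]; split => [n|]; first by apply: Acv; exists l.
by exists (T l); exact: lim.
Qed.

Lemma limit_preserving_necessary : strongly_selective J ->
  limit_preserving A I J T ->
  [/\ exists k0 J0, dual_filter J J0 /\
        exists M, forall n, J0 n -> tail_bounded (A n) k0 M,
      forall x n, c_space I x -> row_converges A x n,
      row_sums_lim A J T
    & mx_maps A (c00_space I) (c0_space J)].
Proof.
move=> Jsel [Amap Alim].
have cI (x : nat -> X) l : ideal_lim I x l -> c_space I x by exists l.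
have lim0 x : ideal_lim I x 0 -> ideal_lim J (mx_apply A x) 0.
  by move=> /Alim; rewrite linear0.
split.
- apply: selective_tail_bounded => // y y0.
  have Iy : ideal_lim I y 0 by exact: cvg_ideal_lim.
  have [Ay _] := Amap _ (cI _ _ Iy).
  by split; [exact: Ay|exact: lim0].
- by move=> x n /Amap[].
- split => [x n|x]; last by apply: Alim; exact: ideal_lim_cst.
  have [Ax _] := Amap _ (cI _ _ (ideal_lim_cst x hI)); exact: Ax.
- move=> x /(c00_c0_space _ _ hI) Ix; have [Ax _] := Amap _ (cI _ _ Ix).
  by split; [exact: Ax|exact: lim0].
Qed.

End LimitPreserving.

Theorem theorem2p21 (R : realType) (X Y : completeNormedModType R)
    (T : {linear X -> Y}) (I J : set (set nat))
    (hI : is_ideal I) (hJ : is_ideal J) (hJsel : strongly_selective J)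
    (A : nat -> nat -> {linear X -> Y}) :
  (limit_preserving A I J T <->
   exists k0 : nat,
     [/\ exists (J0 : set nat) (f : nat -> nat), tail_bounds A J k0 J0 f,
         forall x n, c_space I x -> row_converges A x n,
         row_sums_lim A J T
       & mx_maps A (c00_space I) (c0_space J)])
  /\
  ((forall n k, bounded_fun_norm (A n k)) ->
   (limit_preserving A I J T <->
    [/\ exists J0 : set nat, tail_bounds A J 0 J0 (fun=> 0%N),
        forall x n, c_space I x -> row_converges A x n,
        row_sums_lim A J T
      & mx_maps A (c00_space I) (c0_space J)])).
Proof.
have sufficient k0 J0 f : tail_bounds A J k0 J0 f ->
    (forall x n, c_space I x -> row_converges A x n) ->
    row_sums_lim A J T -> mx_maps A (c00_space I) (c0_space J) ->
    limit_preserving A I J T.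
  by move=> [JJ0 /sup_group_norm_lty[M AM] _]; exact: limit_preserving_of_tail_bounded AM.
have rows : (forall x n, c_space I x -> row_converges A x n) ->
    forall n, exists m M, tail_bounded (A n) m M.
  move=> Acv n; apply: row_tail_bounded => y y0.
  by apply: Acv; exists 0; exact: cvg_ideal_lim.
split=> [|Abd].
  split=> [/(limit_preserving_necessary _ _ _ _ hI hJ hJsel)|]; last first.
    by move=> [k0 [[J0 [f tb]] Acv AT A00]]; exact: sufficient tb Acv AT A00.
  move=> [[k0 [J0 [JJ0 AM]]] Acv AT A00]; exists k0; split => //.
  have [f fP] := choice (rows Acv); exists J0, f; split => //.
    exact/sup_group_norm_lty.
  by move=> n _; exact/group_norm_from_lty.
split=> [|[[J0 tb] Acv AT A00]]; last exact: sufficient tb Acv AT A00.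
move=> lp; have [[k0 [J0 [JJ0 [M AM]]]] Acv AT A00] :=
  limit_preserving_necessary _ _ _ _ hI hJ hJsel lp.
have Acol k : exists J1, dual_filter J J1 /\
    exists M1, forall n, J1 n -> forall v, `|v| <= 1 -> `|A n k v| <= M1.
  apply: selective_uniform_boundedness => // v.
  have vc : c00_space I (fun i => if i == k then v else 0).
    have [Isub _ Ifin _] := hI; apply: Isub (Ifin _ (finite_set1 k)) => i /=.
    by case: eqP.
  have [_] := A00 _ vc; rewrite /c0_space /=.
  by congr ideal_lim; apply/funext => n; exact: mx_apply_delta.
have [J1 [JJ1 AM1]] := dual_tail_bounded0 _ _ _ _ _ hJ Acol JJ0 AM.
split => //; exists J1; split => //; first exact/sup_group_norm_lty.
move=> n _; apply/group_norm_from_lty.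
have [m [M' aM']] := rows Acv n; exact: tail_bounded0 aM'.
Qed.
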